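(* Let $\mathbb{G}$ be a pseudo-orientable ribbon graph and let $Q$ be a quasi-tree of $\mathbb{G}$. Then there is an integral principally unimodular square matrix $\mathbf{M}$, with rows and columns indexed by $E(\mathbb{G})$, such that for every $X\subseteq E(\mathbb{G})$, \[\det(\mathbf{M}[Q\triangle X])=\begin{cases}1 & \text{if } X \text{ is a quasi-tree of } \mathbb{G},\\ 0 & \text{otherwise.}\end{cases}\] In particular, $\det(\mathbf{I}+\mathbf{M})$ equals the number of quasi-trees of $\mathbb{G}$.
   Context: A ribbon graph $\mathbb{G}$ is a surface with boundary written as the union of vertex discs $V(\mathbb{G})$ and edge discs $E(\mathbb{G})$, where vertices and edges meet in disjoint line segments, each on the boundary of exactly one vertex and one edge, and each edge contains exactly two such segments. For a connected ribbon graph, a quasi-tree is $F\subseteq E(\mathbb{G})$ such that the spanning ribbon subgraph $(V(\mathbb{G}),F)$ has exactly one boundary component; in general, a quasi-tree is a union of quasi-trees of the components. For $X\subseteq E(\mathbb{G})$ the partial dual $\mathbb{G}^X$ has the same edges and has as vertices discs glued along the boundary components of $(V(\mathbb{G}),X)$ (old vertices discarded). A bouquet is a ribbon graph with one vertex; a loop $e$ is orientable if $v\cup e$ is an annulus, non-orientable if it is a Möbius band. A bouquet is pseudo-orientable if its vertex boundary circle is the union of two closed arcs $S_1,S_2$ meeting in exactly two points such that both ends of each orientable loop lie in the interior of a single $S_i$ and each non-orientable loop has one end in the interior of $S_1$ and one in the interior of $S_2$. A connected ribbon graph is pseudo-orientable if $\mathbb{G}^X$ is a pseudo-orientable bouquet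 for some quasi-tree $X$; a general ribbon graph is pseudo-orientable if one component is pseudo-orientable and all others are orientable. $\mathbf{M}[Y]$ denotes the principal submatrix indexed by $Y$, with $\det(\mathbf{M}[\emptyset])=1$. A matrix is principally unimodular (PU) if all its principal minors lie in $\{0,\pm1\}$. *)

(* Defs.v *)
From HB Require Import structures.
From mathcomp Require Import all_boot all_order all_algebra.
Set Implicit Arguments. Unset Strict Implicit. Unset Printing Implicit Defensive.
Import Order.TTheory GRing.Theory Num.Theory.

Section Ribbon.
Variable E : finType.

(* A flag (corner of an edge ribbon): (edge e, end i, side s).  Each edge
   ribbon is a rectangle whose two ends i = false/true are attached to
   vertices; its four corners are the flags (e,i,s). *)
Definition Flag := (E * bool * bool)%type.
Definition fedge (f : Flag) : E := f.1.1.

(* same end, other side: crosses the attachment segment *)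
Definition alpha (f : Flag) : Flag := (f.1.1, f.1.2, ~~ f.2).
(* same side, other end: runs along a long side of the edge ribbon *)
Definition beta (f : Flag) : Flag := (f.1.1, ~~ f.1.2, f.2).

(* A ribbon graph is given by an involution sigma on flags without fixed
   points (sigma f is the corner reached from f along the vertex boundary
   arc starting at f) together with a number of isolated vertices. *)
Definition is_ribbon (sigma : Flag -> Flag) : Prop :=
  (forall f, sigma (sigma f) = f) /\ (forall f, sigma f != f).

Variable sigma : Flag -> Flag.

Definition gconn : rel Flag :=
  connect [rel f g | [|| g == sigma f, g == alpha f | g == beta f]].
(* components having at least one edge (isolated vertices are separate) *)
Definition comps : {set {set Flag}} := [set [set g | gconn f g] | f : Flag].

(* flags on the same vertex boundary circle *)
Definition vconn : rel Flag :=
  connect [rel f g | (g == sigma f) || (g == alpha f)].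

(* boundary of the spanning ribbon subgraph (V, X): along an edge of X go
   along its long side, along an edge not in X cross its (former)
   attachment segment. *)
Definition gamma (X : {set E}) (f : Flag) : Flag :=
  if fedge f \in X then beta f else alpha f.
Definition bconn (X : {set E}) : rel Flag :=
  connect [rel f g | (g == sigma f) || (g == gamma X f)].

(* number of boundary components of (V(C), X ∩ E(C)) for the component C
   with flag set K; (V(C), ...) for an isolated vertex C has one. *)
Definition nbound_on (K : {set Flag}) (X : {set E}) : nat :=
  #|[set [set g | bconn X f g] | f in K]|.

Definition quasi_tree_on (K : {set Flag}) (X : {set E}) : bool :=
  nbound_on K X == 1%N.

Definition quasi_tree (X : {set E}) : bool :=
  [forall K in comps, quasi_tree_on K X].

(* orientability of the surface of the component with flag set K:
   the flag graph (sigma, alpha, beta) restricted to K is bipartite. *)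
Definition orientable_on (K : {set Flag}) : Prop :=
  exists c : Flag -> bool, forall f, f \in K ->
    [&& c (sigma f) != c f, c (alpha f) != c f & c (beta f) != c f].

Definition sub_orientable (F : {set E}) : Prop :=
  exists c : Flag -> bool, forall f,
    [/\ c (sigma f) != c f, c (alpha f) != c f &
        (fedge f \in F -> c (beta f) != c f)].

(* loop e (at vertex v) is orientable iff v ∪ e is an annulus, i.e. the
   ribbon subgraph (V, {e}) is orientable *)
Definition orientable_loop (e : E) : Prop := sub_orientable [set e].

(* the component with flag set K is a bouquet (one vertex) which is
   pseudo-orientable: a labelling c of the attachment segments by the two
   arcs S_1 (true) / S_2 (false), constant on each segment, changing
   at most twice around the vertex circle (at most 4 flags f with
   c (sigma f) != c f), such that orientable loops have both ends in
   the same arc and non-orientable loops one end in each. *)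
Definition pseudo_bouquet_on (K : {set Flag}) : Prop :=
  #|[set [set g | vconn f g] | f in K]| = 1%N /\
  exists c : Flag -> bool,
    [/\ forall f, f \in K -> c (alpha f) = c f,
        (#|[set f in K | c (sigma f) != c f]| <= 4)%N &
        forall e : E, (e, false, false) \in K ->
          (orientable_loop e -> c (e, false, false) = c (e, true, false)) /\
          (~ orientable_loop e -> c (e, false, false) != c (e, true, false))].

End Ribbon.

Section PartialDual.
Variable E : finType.

Definition rho (X : {set E}) (f : Flag E) : Flag E :=
  if fedge f \in X then (f.1.1, f.2, f.1.2) else f.

(* partial dual G^X (the number of isolated vertices is unchanged) *)
Definition pdual (sigma : Flag E -> Flag E) (X : {set E}) : Flag E -> Flag E :=
  fun f => rho X (sigma (rho X f)).

Definition pseudo_orientable_on (sigma : Flag E -> Flag E) (K : {set Flag E}) : Prop :=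
  exists X : {set E},
    [/\ forall e, e \in X -> (e, false, false) \in K,
        quasi_tree_on sigma K X &
        pseudo_bouquet_on (pdual sigma X) K].

(* one component pseudo-orientable, all others orientable; an isolated
   vertex is both orientable and pseudo-orientable *)
Definition pseudo_orientable (sigma : Flag E -> Flag E) (niso : nat) : Prop :=
  (exists2 K, K \in comps sigma &
     pseudo_orientable_on sigma K /\
     forall K', K' \in comps sigma -> K' != K -> orientable_on sigma K')
  \/ ((0 < niso)%N /\ forall K, K \in comps sigma -> orientable_on sigma K).

End PartialDual.

Section Matrices.
Local Open Scope ring_scope.
Variable E : finType.

Definition principal_minor (M : 'M[int]_#|E|) (Y : {set E}) : int :=
  \det (\matrix_(i < #|Y|, j < #|Y|)
          M (enum_rank (enum_val i)) (enum_rank (enum_val j))).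

Definition principally_unimodular (M : 'M[int]_#|E|) : Prop :=
  forall Y : {set E}, principal_minor M Y \in [:: 0; 1; -1].

Definition symdiff (A B : {set E}) : {set E} := (A :\: B) :|: (B :\: A).
End Matrices.

(* Main.v *)
Require Import Defs.
From HB Require Import structures.
From mathcomp Require Import all_boot all_order all_algebra all_fingroup.
Import GRing.Theory Num.Theory.
Local Open Scope ring_scope.

Set Implicit Arguments. Unset Strict Implicit. Unset Printing Implicit Defensive.

(* For a permutation matrix C and a set R of indices, the determinant of I - C
   with the rows in R replaced by identity rows is 1 if every cycle of C meets R
   and 0 otherwise.  If the flags are 2-coloured so that sigma, alpha and beta
   all change the colour, the boundary components of (V, X) are the cycles of
   the permutation that follows sigma on one colour and gamma X on the other;
   with R a transversal of the components, the determinant above is 1 exactly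
   when X is a quasi-tree.  Passing from Q to X multiplies the permutation by
   disjoint transpositions, one for each edge of the symmetric difference Y, that
   is, adds a sum of rank-one terms indexed by Y, and det (1 + A B) =
   det (1 + B A) turns the determinant into a principal minor on Y.

   In the pseudo-orientable case the colouring fails on exactly two arcs of
   sigma, p - sigma p and q - sigma q, one of each colour.  Each of the two other
   matchings of these four flags restores the colouring, and X is a quasi-tree
   for sigma iff it is one for exactly one of them.  The two permutations differ
   by a transposition, so the sum of the two determinants is again a principal
   minor, of a rank-one perturbation of the matrix of one of them. *)

(** * Determinants *)

Lemma det_mulmx_det1 (R : comNzRingType) (n : nat) (B A : 'M[R]_n) :
  \det B = 1 -> \det (A *m B) = \det A.
Proof. by move=> dB; rewrite det_mulmx dB mulr1. Qed.

(** Both sides are the determinant of the block matrix with rows [(1, -A)] and [(B, 1)]: clearing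
    its lower left block gives one, clearing its upper right block the other. *)
Lemma det_add1_mulmxC (R : comNzRingType) (m n : nat)
    (A : 'M[R]_(m, n)) (B : 'M[R]_(n, m)) :
  \det (1%:M + A *m B) = \det (1%:M + B *m A).
Proof.
have <- : \det (block_mx 1%:M (- A) B 1%:M) = \det (1%:M + A *m B).
  rewrite -(@det_mulmx_det1 _ _ (block_mx 1%:M 0 (- B) 1%:M)); last first.
    by rewrite det_lblock !det1 mulr1.
  rewrite mulmx_block !mulmx0 ?mul0mx !mulmx1 !mul1mx.
  by rewrite mulmxN mulNmx opprK subrr ?add0r ?addr0 det_ublock det1 mulr1.
rewrite -(@det_mulmx_det1 _ _ (block_mx 1%:M A 0 1%:M)); last first.
  by rewrite det_ublock !det1 mulr1.
rewrite mulmx_block !mulmx0 !mulmx1 !mul1mx.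
by rewrite subrr !addr0 det_lblock det1 mul1r addrC.
Qed.

(** The last rows [(0, 1)] and [(k, 0)] add up to [(k, 1)], and the corner 1 eliminates the border.
    This merges a sum of two determinants into one. *)
Lemma det_add_block_corner (R : comNzRingType) (n : nat)
    (P : 'M[R]_n) (b : 'cV[R]_n) (k : 'rV[R]_n) :
  \det P + \det (block_mx P b k 0) = \det (P - b *m k).
Proof.
have <- : \det (block_mx P b k (1%:M : 'M_1)) = \det (P - b *m k).
  rewrite -(@det_mulmx_det1 _ _ (block_mx 1%:M 0 (- k) 1%:M)); last first.
    by rewrite det_lblock !det1 mulr1.
  rewrite mulmx_block !mulmx0 !mulmx1 !mul1mx.
  by rewrite mulmxN subrr !add0r det_ublock det1 mulr1.
have -> : \det P = \det (block_mx P b 0 (1%:M : 'M_1)).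
  by rewrite det_ublock det1 mulr1.
rewrite -[LHS](congr2 +%R (mul1r _) (mul1r _)); apply/esym.
apply: (@determinant_multilinear _ _ _ _ _ (rshift n ord0)).
- rewrite !scale1r !block_mxEv !rowKd /=.
  by apply/rowP=> j; rewrite !mxE; case: splitP => l _; rewrite !mxE ?add0r ?addr0.
- apply/matrixP=> i j; rewrite !mxE.
  case: splitP => l El; first by [].
  case/eqP: (neq_lift (rshift n (ord0 : 'I_1)) i); apply: val_inj.
  by rewrite [RHS]El [l]ord1.
- apply/matrixP=> i j; rewrite !mxE.
  case: splitP => l El; first by [].
  case/eqP: (neq_lift (rshift n (ord0 : 'I_1)) i); apply: val_inj.
  by rewrite [RHS]El [l]ord1.
Qed.

Definition mask_mx (T : finType) (Y : {set T}) : 'M[int]_#|T| :=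
  diag_mx (\row_i (enum_val i \in Y)%:R).

(** The full-size matrix has the rows of [M] on [Y] and identity rows elsewhere. With [P] selecting
    the coordinates in [Y], [P^T *m P] is the mask and [P *m P^T = 1], so exchanging factors shrinks
    it to [Y]. *)
Lemma principal_minorE (E : finType) (M : 'M[int]_#|E|) (Y : {set E}) :
  principal_minor M Y = \det (1%:M + mask_mx Y *m (M - 1%:M)).
Proof.
pose P : 'M[int]_(#|Y|, #|E|) := \matrix_(i, j) (enum_val i == enum_val j)%:R.
have PPT : P *m P^T = 1%:M.
  apply/matrixP=> i j; rewrite !mxE (bigD1 (enum_rank (enum_val i))) //=.
  rewrite !mxE enum_rankK eqxx mul1r big1 ?addr0.
    by rewrite (inj_eq enum_val_inj) eq_sym.
  move=> k nk; rewrite !mxE; case: eqP => [ek|]; last by rewrite mul0r.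
  by case/eqP: nk; rewrite ek enum_valK.
have PTP : P^T *m P = mask_mx Y.
  apply/matrixP=> i j; rewrite !mxE.
  have [iY|niY] := boolP (enum_val i \in Y).
    rewrite (bigD1 (enum_rank_in iY (enum_val i))) //= big1 ?addr0.
      by rewrite !mxE enum_rankK_in // eqxx mul1r (inj_eq enum_val_inj) mulrb.
    move=> k nk; rewrite !mxE; case: eqP => [ek|]; last by rewrite mul0r.
    by case/eqP: nk; apply: enum_val_inj; rewrite enum_rankK_in.
  rewrite big1 ?mul0rn // => k _; rewrite !mxE; case: eqP => [ek|]; last by rewrite mul0r.
  by case/negP: niY; rewrite -ek enum_valP.
rewrite -PTP -mulmxA det_add1_mulmxC mulmxBr mulmx1 mulmxBl PPT addrC subrK.
congr (\det _); apply/matrixP=> i j; rewrite !mxE.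
rewrite (bigD1 (enum_rank (enum_val j))) //= big1 ?addr0; last first.
  move=> k nk; rewrite !mxE; case: eqP => [ek|]; last by rewrite mulr0.
  by case/eqP: nk; rewrite ek enum_valK.
rewrite !mxE enum_rankK eqxx mulr1 (bigD1 (enum_rank (enum_val i))) //= big1 ?addr0.
  by rewrite !mxE enum_rankK eqxx mul1r.
move=> k nk; rewrite !mxE; case: eqP => [ek|]; last by rewrite mul0r.
by case/eqP: nk; rewrite ek enum_valK.
Qed.

(** Expand each product over the set of rows in which [M], rather than the identity, is chosen. *)
Lemma det_add1_sum_minors (E : finType) (M : 'M[int]_#|E|) :
  \det (1%:M + M) = \sum_(Y : {set E}) principal_minor M Y.
Proof.
rewrite [LHS]/determinant.
under eq_bigr => s _.
  rewrite (eq_bigr (fun i => M i (s i) + 1%:M i (s i))); last first.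
    by move=> i _; rewrite !mxE addrC.
  rewrite (bigA_distr _ _ (fun i => M i (s i))) /= mulr_sumr; over.
rewrite exchange_big /=.
pose h (Y : {set E}) := [set i : 'I_#|E| | enum_val i \in Y].
rewrite (reindex h) /=; last first.
  exists (fun J : {set 'I_#|E|} => [set e | enum_rank e \in J]) => J _.
    by apply/setP=> e; rewrite !inE enum_rankK.
  by apply/setP=> i; rewrite !inE enum_valK.
apply: eq_big => [Y|Y _]; first by rewrite inE.
rewrite principal_minorE /determinant; apply: eq_bigr => s _; congr (_ * _).
apply: eq_bigr => i _; rewrite inE mul_diag_mx !mxE.
by case: (_ \in _); rewrite ?mul1r ?mul0r ?addr0 // addrC subrK.
Qed.

(** A permutation with a nonzero term never increases the height [h]; since it preserves the sum of
    all heights, it must be the identity. *)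
Lemma det_unitriangular (n : nat) (h : 'I_n -> nat) (A : 'M[int]_n) :
  (forall i, A i i = 1) ->
  (forall i j, i != j -> A i j != 0 -> (h j < h i)%N) -> \det A = 1.
Proof.
move=> A1 Ah; rewrite /determinant (bigD1 1%g) //= odd_perm1 mul1r.
rewrite big1 ?addr0 => [|i _]; last by rewrite perm1.
rewrite big1 ?addr0 // => s ns1; apply/eqP; rewrite mulf_eq0; apply/orP; right.
apply/negPn/negP=> nz; case/negP: ns1.
have nzi i : A i (s i) != 0.
  by apply: contraNneq nz => e; rewrite (bigD1 i) //= e mul0r.
have le i : (h (s i) <= h i)%N.
  by have [<-//|ne] := eqVneq i (s i); apply/ltnW/Ah.
have sumh : (\sum_i h (s i) = \sum_i h i)%N.
  by rewrite [RHS](reindex_inj (@perm_inj _ s)).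
apply/eqP/permP=> i; rewrite perm1; apply/eqP; rewrite eq_sym.
apply/negPn/negP=> ne; have lt := Ah _ _ ne (nzi i).
have : (\sum_i h (s i) < \sum_i h i)%N.
  rewrite (bigD1 i) //= [X in (_ < X)%N](bigD1 i) //= -addSn.
  by apply: leq_add => //; apply: leq_sum.
by rewrite sumh ltnn.
Qed.

Lemma porbit_step (T : finType) (s : {perm T}) x : porbit s (s x) = porbit s x.
Proof. by have := porbit_perm s 1 x; rewrite expg1. Qed.

(** * Determinants that detect orbits missing a set *)

Section OrbitDeterminant.
Variables (T : finType) (R : {set T}).

Definition all_orbits_meet (s : {perm T}) : bool :=
  [forall f, exists r in R, r \in porbit s f].

Definition fun_mx (s : T -> T) : 'M[int]_#|T| :=
  \matrix_(i, j) (enum_val j == s (enum_val i))%:R.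

Lemma all_orbits_meetP (s : {perm T}) :
  reflect (forall f, exists2 r, r \in R & r \in porbit s f) (all_orbits_meet s).
Proof. by apply: (iffP forallP) => H f; apply/exists_inP. Qed.

(* This is the Laplacian of the functional graph of s, with the rows of the
   vertices in R replaced by those of the identity. *)
Lemma det_orbits (s : {perm T}) :
  \det (1%:M - mask_mx (~: R) *m fun_mx s) = (all_orbits_meet s)%:R.
Proof.
have ent i j : (1%:M - mask_mx (~: R) *m fun_mx s) i j =
    (i == j)%:R - ((enum_val i \notin R) && (enum_val j == s (enum_val i)))%:R.
  by rewrite mul_diag_mx !mxE inE; case: (_ \in R); rewrite ?mul1r ?mul0r.
have [/all_orbits_meetP H|] := boolP (all_orbits_meet s).
  have exn f : exists n, (s ^+ n)%g f \in R.
    by case: (H f) => r rR /porbitP[n En]; exists n; rewrite -En.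
  (* The height is the number of steps of [s] needed to reach [R]. *)
  pose h f := ex_minn (exn f).
  have hlt f : f \notin R -> (h (s f) < h f)%N.
    rewrite {2}/h; case: ex_minnP => [] [|m]; first by rewrite expg0 perm1 => ->.
    rewrite expgS permM => mR _ _; rewrite /h; case: ex_minnP => k _ /(_ m).
    by rewrite ltnS; apply.
  apply: (@det_unitriangular _ (fun i => h (enum_val i))) => [i|i j nij].
    rewrite ent eqxx; case: andP => [[nR /eqP Es]|]; last by rewrite subr0.
    by have := hlt _ nR; rewrite -Es ltnn.
  rewrite ent (negPf nij) sub0r oppr_eq0.
  case: andP => [[nR /eqP ->] _|]; last by rewrite eqxx.
  exact: hlt.
rewrite negb_forall => /existsP[f]; rewrite negb_exists => /forallP nf.
set B := (1%:M - _ in LHS).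
(* The indicator of an orbit that avoids [R] is a kernel vector; multiplying by the adjugate shows
   that the determinant vanishes. *)
pose v : 'cV[int]_#|T| := \col_i (enum_val i \in porbit s f)%:R.
have Bv : B *m v = 0.
  rewrite mulmxBl mul1mx -mulmxA mul_diag_mx; apply/colP=> i; rewrite !mxE.
  rewrite (bigD1 (enum_rank (s (enum_val i)))) //= big1 ?addr0.
    rewrite !mxE enum_rankK eqxx mul1r !inE.
    have -> : (s (enum_val i) \in porbit s f) = (enum_val i \in porbit s f).
      by rewrite -!eq_porbit_mem porbit_step.
    have := nf (enum_val i); rewrite negb_and.
    by case: (_ \in R); case: (_ \in porbit _ _); rewrite //= ?mul1r ?mul0r subrr.
  move=> k nk; rewrite !mxE; case: eqP => [ek|]; last by rewrite mul0r.
  by case/eqP: nk; rewrite -ek enum_valK.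
have := mulmxA (\adj B) B v; rewrite Bv mulmx0 mul_adj_mx mul_scalar_mx.
move/colP/(_ (enum_rank f)); rewrite !mxE enum_rankK porbit_id mulr1.
by move=> <-.
Qed.

End OrbitDeterminant.

(** * Perturbed determinants as principal minors *)

Section PivotMatrices.
Variables (n : nat) (E : finType).
Variables (A : 'M[int]_n) (V : 'M[int]_(n, #|E|)) (D : 'M[int]_(#|E|, n)).
Hypothesis detA : \det A = 1.

Let W := \adj A.

Let AW : A *m W = 1%:M.
Proof. by rewrite mul_mx_adj detA. Qed.

Let det_factor (Z : 'M[int]_n) : \det (A + Z) = \det (1%:M + W *m Z).
Proof.
have -> : A + Z = A *m (1%:M + W *m Z) by rewrite mulmxDr mulmx1 mulmxA AW mul1mx.
by rewrite det_mulmx detA mul1r.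
Qed.

(** As [\det A = 1], the adjugate [W] is an integral inverse. Factoring out [A] and exchanging
    factors leaves [1 + mask_mx Y *m (D *m W *m V)]. *)
Lemma pivot_matrix_exists :
  exists M : 'M[int]_#|E|, forall Y : {set E},
    principal_minor M Y = \det (A + V *m mask_mx Y *m D).
Proof.
exists (1%:M + D *m W *m V) => Y.
rewrite principal_minorE addrAC subrr add0r det_factor.
by rewrite -(mulmxA V) (mulmxA W) [RHS]det_add1_mulmxC !mulmxA.
Qed.

(* The condition on A + x y makes the Schur complement below have corner 0. *)
Lemma rank_one_pivot_matrix_exists (x : 'cV[int]_n) (y : 'rV[int]_n) :
  \det (A + x *m y) = 0 ->
  exists M : 'M[int]_#|E|, forall Y : {set E},
    principal_minor M Y =
      \det (A + V *m mask_mx Y *m D) + \det (A + V *m mask_mx Y *m D + x *m y).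
Proof.
rewrite det_factor mulmxA det_add1_mulmxC => ywx.
(* The second determinant equals that of [P] bordered by the column [b], the row [y *m W *m V] and
   the corner [1 + y *m W *m x], which is 0 by [ywx]. [det_add_block_corner] then gives the
   subtracted term. *)
exists (1%:M + D *m W *m V - D *m W *m x *m (y *m W *m V)) => Y.
rewrite principal_minorE addrAC [_ + D *m W *m V]addrC addrK.
pose P := 1%:M + mask_mx Y *m (D *m W *m V).
pose b := mask_mx Y *m (D *m W *m x).
rewrite mulmxBr addrA -/P (mulmxA (mask_mx Y) (D *m W *m x)) -/b -det_add_block_corner.
congr (_ + _).
  by rewrite det_factor -(mulmxA V) (mulmxA W) [RHS]det_add1_mulmxC /P !mulmxA.
rewrite -addrA det_factor.
have -> : V *m mask_mx Y *m D + x *m y = row_mx V x *m col_mx (mask_mx Y *m D) y.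
  by rewrite mul_row_col !mulmxA.
rewrite mulmxA det_add1_mulmxC mul_mx_row mul_col_row.
rewrite scalar_mx_block add_block_mx !add0r !mulmxA; congr (\det _).
rewrite /P /b !mulmxA; congr block_mx.
have -> : (0 : 'M_1) = (\det (1%:M + y *m (W *m x)))%:M by rewrite ywx raddf0.
by rewrite det_mx11 -mx11_scalar !mulmxA.
Qed.

End PivotMatrices.

(** * Boundary components as cycles of a permutation *)

Lemma mul_fun_mx (T : finType) (s : T -> T) (n : nat) (A : 'M[int]_(#|T|, n)) i j :
  (fun_mx s *m A) i j = A (enum_rank (s (enum_val i))) j.
Proof.
rewrite mxE (bigD1 (enum_rank (s (enum_val i)))) //= mxE enum_rankK eqxx mul1r.
rewrite big1 ?addr0 // => k nk; rewrite mxE; case: eqP => [ek|]; last by rewrite mul0r.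
by case/eqP: nk; rewrite -ek enum_valK.
Qed.

Section FlagMaps.
Variable E : finType.
Implicit Types (f g : Flag E) (X : {set E}).

Lemma alphaK : involutive (@alpha E).
Proof. by case=> [[e i] s]; rewrite /alpha /= negbK. Qed.

Lemma betaK : involutive (@beta E).
Proof. by case=> [[e i] s]; rewrite /beta /= negbK. Qed.

Lemma fedge_gamma X f : fedge (gamma X f) = fedge f.
Proof. by rewrite /gamma; case: ifP. Qed.

Lemma gammaK X : involutive (gamma X).
Proof.
case=> [[e i] s]; rewrite /gamma /fedge /=.
by case eX: (e \in X) => /=; rewrite eX ?alphaK ?betaK.
Qed.

Lemma rhoK X : involutive (rho X).
Proof.
by case=> [[e i] s]; rewrite /rho /fedge /=; case eX: (e \in X) => /=; rewrite eX.
Qed.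

End FlagMaps.

Section Boundaries.
Variables (E : finType) (sigma : Flag E -> Flag E).
Hypothesis sigmaK : involutive sigma.
Implicit Types (f g : Flag E) (X : {set E}).

Lemma bconn_sym X f g : bconn sigma X f g = bconn sigma X g f.
Proof.
apply: sym_connect_sym => {}f {}g /=.
by congr orb; apply/eqP/eqP => ->; rewrite ?sigmaK ?gammaK.
Qed.

Lemma gconn_sym f g : gconn sigma f g = gconn sigma g f.
Proof.
apply: sym_connect_sym => {}f {}g /=.
by congr [|| _, _ | _]; apply/eqP/eqP => ->; rewrite ?sigmaK ?alphaK ?betaK.
Qed.

Lemma gconn_sigma f : gconn sigma f (sigma f).
Proof. by apply: connect1; rewrite /= eqxx. Qed.

Lemma gconn_alpha f : gconn sigma f (alpha f).
Proof. by apply: connect1; rewrite /= eqxx orbT. Qed.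

Lemma gconn_beta f : gconn sigma f (beta f).
Proof. by apply: connect1; rewrite /= eqxx !orbT. Qed.

Lemma gconn_gamma X f : gconn sigma f (gamma X f).
Proof. by rewrite /gamma; case: ifP; rewrite (gconn_alpha, gconn_beta). Qed.

Lemma bconn_sigma X f : bconn sigma X f (sigma f).
Proof. by apply: connect1; rewrite /= eqxx. Qed.

Lemma bconn_gamma X f : bconn sigma X f (gamma X f).
Proof. by apply: connect1; rewrite /= eqxx orbT. Qed.

Lemma bconn_gconn X f g : bconn sigma X f g -> gconn sigma f g.
Proof.
apply: connect_sub => {}f {}g /= /orP[] /eqP->; first exact: gconn_sigma.
exact: gconn_gamma.
Qed.

Lemma bconn_closed X (P : pred (Flag E)) f g :
  (forall h, P h -> P (sigma h)) -> (forall h, P h -> P (gamma X h)) ->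
  bconn sigma X f g -> P f -> P g.
Proof.
move=> Ps Pg /connectP[p]; elim: p f => [|h p IH] f /=; first by move=> _ ->.
case/andP=> step path_p eg Pf; apply: (IH _ path_p eg).
by case/orP: step => /eqP->; [apply: Ps | apply: Pg].
Qed.

Definition comp_transversal (R : {set Flag E}) : Prop :=
  (forall f, exists2 r, r \in R & gconn sigma f r) /\
  {in R &, forall r r', gconn sigma r r' -> r = r'}.

(** Canonical roots represent the components, except that [p] represents its own. Prescribing [p]
    serves the twisted case, where [p] is an end of an exceptional arc. *)
Lemma comp_transversal_exists p : exists2 R, comp_transversal R & p \in R.
Proof.
pose e := [rel f g | [|| g == sigma f, g == alpha f | g == beta f]].
have esym : connect_sym e by exact: gconn_sym.
pose rr f := if gconn sigma f p then p else fingraph.root e f.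
have rrP f : gconn sigma f (rr f).
  by rewrite /rr; case: ifP => // _; apply: connect_root.
have rrE f g : gconn sigma f g -> rr f = rr g.
  move=> fg; rewrite /rr.
  rewrite (_ : gconn sigma f p = gconn sigma g p); last exact: same_connect fg _.
  by case: ifP => // _; apply/eqP; rewrite root_connect.
exists [set rr f | f : Flag E].
  split=> [f|r r']; first by exists (rr f); rewrite ?imset_f.
  move=> /imsetP[f _ ->] /imsetP[g _ ->] c.
  apply: rrE; apply: connect_trans (rrP f) _; apply: connect_trans c _.
  by rewrite -[connect _ _ _]/(gconn sigma _ _) gconn_sym.
by apply/imsetP; exists p; rewrite // /rr /gconn connect0.
Qed.

(** Boundary components stay inside components of the graph, and each of those contains a single
    member of [R]. *)
Lemma quasi_tree_transversal (R : {set Flag E}) X : comp_transversal R ->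
  (quasi_tree sigma X <-> forall f, exists2 r, r \in R & bconn sigma X f r).
Proof.
case=> R1 R2; split=> [/forall_inP QT f|H].
  have [r rR fr] := R1 f; exists r => //.
  have Kc : [set g | gconn sigma f g] \in comps sigma by apply: imset_f.
  have /cards1P[C EC] := QT _ Kc.
  have inC h : gconn sigma f h -> [set g | bconn sigma X h g] = C.
    by move=> fh; apply/set1P; rewrite -EC; apply: imset_f; rewrite inE.
  have : r \in [set g | bconn sigma X r g] by rewrite inE /bconn connect0.
  by rewrite (inC r fr) -(inC f (connect0 _ _)) inE.
apply/forall_inP=> K /imsetP[f0 _ ->]; have [r0 r0R fr0] := H f0.
have br0 f : gconn sigma f0 f -> bconn sigma X f r0.
  move=> f0f; have [r rR fr] := H f; rewrite -(R2 r r0) //.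
  apply: connect_trans (bconn_gconn fr0).
  rewrite -[connect _ _ _]/(gconn sigma _ _) gconn_sym.
  exact: connect_trans f0f (bconn_gconn fr).
apply/cards1P; exists [set g | bconn sigma X r0 g]; apply/setP=> C.
apply/imsetP/set1P => [[f]|->]; last first.
  by exists r0 => //; rewrite inE (bconn_gconn fr0).
rewrite inE => /br0 br ->; apply/setP=> g; rewrite !inE.
exact: same_connect (bconn_sym X) _ _ br g.
Qed.

End Boundaries.

(** * The boundary walk defined by a two-colouring *)

Section AlternatingPermutation.
Variables (E : finType) (o : Flag E -> bool) (m : Flag E -> Flag E).
Hypothesis o_alpha : forall f, o (alpha f) = ~~ o f.
Hypothesis o_beta : forall f, o (beta f) = ~~ o f.
Hypothesis m_flip : forall f, o f -> ~~ o (m f).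
Hypothesis m_inj : injective m.
Implicit Types (f g : Flag E) (X : {set E}).

Lemma o_gamma X f : o (gamma X f) = ~~ o f.
Proof. by rewrite /gamma; case: ifP. Qed.

(** The colour fixes a direction of travel, so that for [m = sigma] a boundary component is one
    cycle. The map [m] is left general to allow a rematching of [sigma]. *)
Let walk X f := if o f then m f else gamma X f.

Let o_walk X f : o (walk X f) = ~~ o f.
Proof.
by rewrite /walk; case: ifP => [/m_flip/negPf|of0]; rewrite ?o_gamma ?of0.
Qed.

Lemma walk_inj X : injective (walk X).
Proof.
move=> f g e; have /negb_inj ofg : ~~ o f = ~~ o g by rewrite -!(o_walk X) e.
move: e; rewrite /walk ofg; case: ifP => _; first exact: m_inj.
exact/inv_inj/gammaK.
Qed.

Definition walk_perm X : {perm Flag E} := perm (@walk_inj X).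

Lemma walk_permE X f : walk_perm X f = if o f then m f else gamma X f.
Proof. by rewrite permE. Qed.

Lemma o_walk_perm X f : o (walk_perm X f) = ~~ o f.
Proof. by rewrite permE o_walk. Qed.

Lemma walk_perm_gamma X f g :
  f \in porbit (walk_perm X) g -> gamma X f \in porbit (walk_perm X) g.
Proof.
rewrite -!eq_porbit_mem => /eqP <-; case of0: (o f).
  by rewrite -(porbit_step _ (gamma X f)) walk_permE o_gamma of0 gammaK.
by rewrite -[in X in _ == X](porbit_step _ f) walk_permE of0.
Qed.

(* The two positively coloured corners of an edge, exchanged when the edge
   enters or leaves the ribbon subgraph. *)
Definition corner0 (e : E) : Flag E := (e, false, ~~ o (e, false, false)).
Definition corner1 (e : E) : Flag E := (e, true, o (e, false, false)).

Definition corner_mx : 'M[int]_(#|E|, #|{: Flag E}|) :=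
  \matrix_(i, j) ((enum_val j == corner0 (enum_val i))%:R
                  - (enum_val j == corner1 (enum_val i))%:R).

Lemma flag_corner f : o f -> f = corner0 (fedge f) \/ f = corner1 (fedge f).
Proof.
case: f => [[e i] s]; rewrite /corner0 /corner1 /fedge /=.
have Hf: o (e, false, true) = ~~ o (e, false, false) by rewrite -o_alpha.
have Ht: o (e, true, false) = ~~ o (e, false, false) by rewrite -o_beta.
have Htt: o (e, true, true) = o (e, false, false).
  by rewrite -[o (e, false, false)]negbK -Hf -o_beta.
by case: i s => [] []; rewrite ?Hf ?Ht ?Htt; case: (o (e, false, false)) => //= _;
  auto.
Qed.

Lemma o_corner e : o (corner0 e) /\ o (corner1 e).
Proof.
have Hf: o (e, false, true) = ~~ o (e, false, false) by rewrite -o_alpha.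
have Ht: o (e, true, false) = ~~ o (e, false, false) by rewrite -o_beta.
have Htt: o (e, true, true) = o (e, false, false).
  by rewrite -[o (e, false, false)]negbK -Hf -o_beta.
by rewrite /corner0 /corner1; case of0: (o (e, false, false));
  rewrite /= ?Hf ?Ht ?Htt of0.
Qed.

(** Toggling an edge composes the walk with the transposition of its two positive corners. As a
    matrix, that transposition is the reflection [1 - d^T *m d], where [d] is the difference of the
    two unit rows; the mask selects the toggled edges. *)
Lemma walk_perm_mx Q X :
  fun_mx (walk_perm X) = fun_mx (walk_perm Q)
    - fun_mx (walk_perm Q) *m corner_mx^T *m mask_mx (symdiff Q X) *m corner_mx.
Proof.
set C := fun_mx (walk_perm Q) *m _; apply/matrixP=> i j.
have CE k : C i k = (walk_perm Q (enum_val i) == corner0 (enum_val k))%:R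
                    - (walk_perm Q (enum_val i) == corner1 (enum_val k))%:R.
  by rewrite mul_fun_mx !mxE enum_rankK.
have -> : (fun_mx (walk_perm Q) - C *m mask_mx (symdiff Q X) *m corner_mx) i j =
    (enum_val j == walk_perm Q (enum_val i))%:R
    - \sum_k C i k * (enum_val k \in symdiff Q X)%:R * corner_mx k j.
  rewrite mxE; congr (_ + _); first by rewrite mxE.
  rewrite mxE; congr (- _); rewrite mxE; apply: eq_bigr => k _.
  by congr (_ * _); rewrite mul_mx_diag mxE; congr (_ * _); rewrite mxE.
rewrite mxE.
move: CE; set f := enum_val i; set g := enum_val j => CE.
(* At a positive flag both walks apply [m], and the image is negative, hence not a corner. *)
case of0: (o f).
  have -> : walk_perm X f = walk_perm Q f by rewrite !walk_permE of0.
  rewrite big1 ?subr0 // => k _.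
  have nof := m_flip of0; have [oc0 oc1] := o_corner (enum_val k).
  rewrite CE walk_permE of0.
  rewrite (_ : m f == corner0 (enum_val k) = false); last first.
    by apply: contraNF nof => /eqP->.
  rewrite (_ : m f == corner1 (enum_val k) = false) ?subrr ?mul0r //.
  by apply: contraNF nof => /eqP->.
have edgeQ : fedge (walk_perm Q f) = fedge f by rewrite walk_permE of0 fedge_gamma.
have oQ : o (walk_perm Q f) by rewrite o_walk_perm of0.
have cne e : corner0 e != corner1 e by apply/eqP; case.
rewrite (bigD1 (enum_rank (fedge f))) //= big1 ?addr0; last first.
  move=> k nk; rewrite CE.
  have ne : fedge (walk_perm Q f) != enum_val k.
    by rewrite edgeQ; apply: contraNneq nk => ->; rewrite enum_valK.
  rewrite (_ : _ == corner0 (enum_val k) = false); last first.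
    by apply: contraNF ne => /eqP->.
  rewrite (_ : _ == corner1 (enum_val k) = false) ?subrr ?mul0r //.
  by apply: contraNF ne => /eqP->.
rewrite CE mxE enum_rankK -/g.
have -> : (fedge f \in symdiff Q X) = (fedge f \in Q) (+) (fedge f \in X).
  by rewrite !inE; case: (_ \in Q); case: (_ \in X).
(* From a negative flag, [alpha] and [beta] lead to the two positive corners of its edge, which
   [alpha \o beta] exchanges. *)
have -> : walk_perm X f = if (fedge f \in Q) (+) (fedge f \in X)
                          then alpha (beta (walk_perm Q f)) else walk_perm Q f.
  rewrite !walk_permE of0 /gamma.
  case: (_ \in Q); case: (_ \in X) => //=; first by rewrite betaK.
  by case: (f) => [[e b] s]; rewrite /alpha /beta /= negbK.
case: (_ (+) _); last by rewrite mulr0 mul0r subr0.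
rewrite mulr1.
have c01 e : alpha (beta (corner0 e)) = corner1 e.
  by rewrite /alpha /beta /corner0 /corner1 /= negbK.
have c10 e : alpha (beta (corner1 e)) = corner0 e by [].
have [] := flag_corner oQ; rewrite edgeQ => ->.
  by rewrite c01 eqxx (negPf (cne _)) subr0 mul1r opprB addrC subrK.
rewrite c10 eqxx [corner1 _ == _]eq_sym (negPf (cne _)) sub0r mulN1r opprK.
by rewrite addrC subrK.
Qed.

End AlternatingPermutation.

(** * Matrices from two-colourings of the flags *)

Section WalkMatrices.
Variables (E : finType) (o : Flag E -> bool) (m : Flag E -> Flag E).
Hypothesis o_alpha : forall f, o (alpha f) = ~~ o f.
Hypothesis o_beta : forall f, o (beta f) = ~~ o f.
Hypothesis m_flip : forall f, o f -> ~~ o (m f).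
Hypothesis m_inj : injective m.
Variables (R : {set Flag E}) (Q : {set E}).

Let s := walk_perm o_alpha o_beta m_flip m_inj.

Lemma walk_laplacian X :
  1%:M - mask_mx (~: R) *m fun_mx (s X) =
  (1%:M - mask_mx (~: R) *m fun_mx (s Q))
  + mask_mx (~: R) *m fun_mx (s Q) *m (corner_mx o)^T
      *m mask_mx (symdiff Q X) *m corner_mx o.
Proof.
rewrite (walk_perm_mx o_alpha o_beta m_flip m_inj Q X) -/s.
by rewrite mulmxBr opprB addrA addrAC !mulmxA.
Qed.

End WalkMatrices.

Lemma symdiffK (E : finType) (Q : {set E}) : involutive (symdiff Q).
Proof.
by move=> Y; apply/setP=> e; rewrite !inE; case: (e \in Q); case: (e \in Y).
Qed.

(** The colouring alternates along every arc, so the cycles of the walk with [m = sigma] are exactly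
    the boundary components. *)
Lemma orientable_matrix (E : finType) (sigma : Flag E -> Flag E)
    (o : Flag E -> bool) (Q : {set E}) :
  involutive sigma ->
  (forall f, o (alpha f) = ~~ o f) -> (forall f, o (beta f) = ~~ o f) ->
  (forall f, o (sigma f) = ~~ o f) -> quasi_tree sigma Q ->
  exists M : 'M[int]_#|E|, forall X,
    principal_minor M (symdiff Q X) = (quasi_tree sigma X)%:R.
Proof.
move=> sigmaK o_alpha o_beta o_sigma QT.
have [R Rtr] : exists R, comp_transversal sigma R.
  (* Without flags there is no [p] to prescribe, and the empty set is a transversal. *)
  case: (pickP {: Flag E}) => [p _|E0].
    by have [R Rt _] := comp_transversal_exists sigmaK p; exists R.
  by exists set0; split=> [f|r]; [have := E0 f | rewrite inE].
have m_flip f : o f -> ~~ o (sigma f) by rewrite o_sigma => ->.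
pose s := walk_perm o_alpha o_beta m_flip (inv_inj sigmaK).
have sE X f : s X f = if o f then sigma f else gamma X f by exact: walk_permE.
have bconnE X f g : bconn sigma X f g = (g \in porbit (s X) f).
  apply/idP/porbitP => [fg|[n ->]].
    apply/porbitP.
    apply: (bconn_closed (P := fun g => g \in porbit (s X) f) _ _ fg) => [h|h|];
      last 2 first.
    - exact: walk_perm_gamma.
    - exact: porbit_id.
    rewrite -!eq_porbit_mem => /eqP <-; case oh: (o h).
      by rewrite -[in X in _ == X](porbit_step _ h) sE oh.
    by rewrite -(porbit_step _ (sigma h)) sE o_sigma oh sigmaK.
  elim: n => [|n IH]; first by rewrite expg0 perm1 /bconn connect0.
  rewrite expgSr permM sE; apply: connect_trans IH _.
  by case: ifP => _; [apply: bconn_sigma | apply: bconn_gamma].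
have QTE X : quasi_tree sigma X = all_orbits_meet R (s X).
  apply/idP/all_orbits_meetP => [/(quasi_tree_transversal sigmaK X Rtr) H f|H].
    by have [r rR] := H f; rewrite bconnE; exists r.
  apply/(quasi_tree_transversal sigmaK X Rtr) => f.
  by have [r rR] := H f; rewrite -bconnE; exists r.
have detQ : \det (1%:M - mask_mx (~: R) *m fun_mx (s Q)) = 1.
  by rewrite det_orbits -QTE QT.
have [M HM] := pivot_matrix_exists (mask_mx (~: R) *m fun_mx (s Q) *m (corner_mx o)^T)
                 (corner_mx o) detQ.
exists M => X; rewrite HM.
by rewrite -(walk_laplacian o_alpha o_beta m_flip (inv_inj sigmaK)) det_orbits QTE.
Qed.

(** * Colourings that fail on two arcs *)

Section Rematching.
Variables (E : finType) (sigma : Flag E -> Flag E).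
Hypothesis sigmaK : involutive sigma.
Hypothesis sigma_neq : forall f, sigma f != f.
Variable o : Flag E -> bool.
Hypothesis o_alpha : forall f, o (alpha f) = ~~ o f.
Hypothesis o_beta : forall f, o (beta f) = ~~ o f.
Variable p : Flag E.
Implicit Types (q f g : Flag E) (X : {set E}).

Definition twisted q : Prop :=
  [/\ o p, o (sigma p), ~~ o q, ~~ o (sigma q) &
      forall f, f \notin [:: p; sigma p; q; sigma q] -> o (sigma f) = ~~ o f].

(** Replacing [q] by [sigma q] yields the second of the two rematchings. *)
Lemma twisted_sigma q : twisted q -> twisted (sigma q).
Proof.
case=> op osp oq osq H; split; rewrite ?sigmaK // => f nf; apply: H.
by move: nf; rewrite !inE ![_ || (f == sigma q)]orbC.
Qed.

(* The arcs p - sigma p and q - sigma q replaced by p - q and sigma p - sigma q,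
   which restores the alternation of o. *)
Definition rematch q f : Flag E := tperm p (sigma q) (tperm (sigma p) q (sigma f)).

Lemma rematch_inj q : injective (rematch q).
Proof. by move=> f g /perm_inj/perm_inj/(inv_inj sigmaK). Qed.

Section Fixed.
Variable q : Flag E.
Hypothesis tw : twisted q.

Let neq_o f g : o f -> ~~ o g -> (f == g) = false.
Proof. by move=> of0 og; apply: contraNF og => /eqP <-. Qed.

Lemma rematch_p : rematch q p = q.
Proof.
by case: tw => op osp oq osq _; rewrite /rematch tpermL tpermD // neq_o.
Qed.

Lemma rematch_sigma_p : rematch q (sigma p) = sigma q.
Proof.
case: tw => op osp oq osq _; rewrite /rematch sigmaK.
by rewrite (@tpermD _ (sigma p)) ?tpermL // eq_sym neq_o.
Qed.

Lemma rematch_rest f : o f -> f != p -> f != sigma p -> rematch q f = sigma f.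
Proof.
case: tw => op osp oq osq _ of0 fp fsp; rewrite /rematch.
rewrite (@tpermD _ (sigma p)) ?(inj_eq (inv_inj sigmaK)) 1?eq_sym //; last first.
  by rewrite (can2_eq sigmaK sigmaK) neq_o.
rewrite tpermD // ?(inj_eq (inv_inj sigmaK)).
  by rewrite eq_sym (can2_eq sigmaK sigmaK).
by rewrite eq_sym neq_o.
Qed.

Lemma o_sigma_rest f : o f -> f != p -> f != sigma p -> ~~ o (sigma f).
Proof.
case: tw => op osp oq osq H of0 fp fsp.
by rewrite H ?of0 // !inE !negb_or fp fsp !neq_o.
Qed.

Lemma rematch_flip f : o f -> ~~ o (rematch q f).
Proof.
case: (tw) => op osp oq osq _ of0.
have [->|fp] := eqVneq f p; first by rewrite rematch_p.
have [->|fsp] := eqVneq f (sigma p); first by rewrite rematch_sigma_p.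
by rewrite rematch_rest // o_sigma_rest.
Qed.

Definition twist_walk X : {perm Flag E} :=
  walk_perm o_alpha o_beta rematch_flip (@rematch_inj q) X.

Lemma twist_walkE X f : twist_walk X f = if o f then rematch q f else gamma X f.
Proof. exact: walk_permE. Qed.

Variable R : {set Flag E}.
Hypothesis pR : p \in R.

(** The walk can leave a boundary component of [sigma] only from [p] or [sigma p], and at that
    moment the component contains [p]. *)
Lemma twist_walk_bconn X f n :
  bconn sigma X f ((twist_walk X ^+ n)%g f) \/ bconn sigma X f p.
Proof.
elim: n => [|n [IH|IH]]; [|case: (boolP (o ((twist_walk X ^+ n)%g f))) => og|by right].
- by left; rewrite expg0 perm1 /bconn connect0.
- set g := (twist_walk X ^+ n)%g f in IH og *.
  have [gp|gp] := eqVneq g p; first by right; rewrite -gp.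
  have [gsp|gsp] := eqVneq g (sigma p).
    right; apply: connect_trans IH _; rewrite gsp -{2}[p]sigmaK.
    exact: bconn_sigma.
  left; rewrite expgSr permM twist_walkE -/g og rematch_rest //.
  exact: connect_trans IH (bconn_sigma _ _ _).
- left; rewrite expgSr permM twist_walkE (negPf og).
  exact: connect_trans IH (bconn_gamma _ _ _).
Qed.

Lemma twist_orbits_meet_bconn X : all_orbits_meet R (twist_walk X) ->
  forall f, exists2 r, r \in R & bconn sigma X f r.
Proof.
move=> /all_orbits_meetP H f; have [r rR /porbitP[n Er]] := H f.
by case: (twist_walk_bconn X f n) => c; [exists r; rewrite // Er | exists p].
Qed.

(** An orbit avoiding [R] avoids [p]. If it also avoided [sigma p], it would avoid their images [q]
    and [sigma q], so it would be closed under [sigma] and [gamma X] and reach [R]. *)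
Lemma bad_orbit_sigma_p X f : (exists2 r, r \in R & bconn sigma X f r) ->
  (forall r, r \in R -> r \notin porbit (twist_walk X) f) ->
  sigma p \in porbit (twist_walk X) f.
Proof.
case=> r rR fr H; case: (tw) => op osp oq osq _; apply/negPn/negP=> nsp.
case/negP: (H r rR); pose O g := g \in porbit (twist_walk X) f.
apply: (bconn_closed (P := O) _ _ fr) => [h hO|h|]; last 2 first.
- exact: walk_perm_gamma.
- exact: porbit_id.
rewrite {}/O in hO *; have np := H p pR.
have inO g : (twist_walk X g \in porbit (twist_walk X) f) =
             (g \in porbit (twist_walk X) f).
  by rewrite -!eq_porbit_mem porbit_step.
have hp : h != p by apply: contraTneq hO => ->.
have hsp : h != sigma p by apply: contraTneq hO => ->.
case oh: (o h).
  by rewrite -(rematch_rest oh) // -[rematch q h](_ : twist_walk X h = _) ?inO //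
    twist_walkE oh.
have hq : h != q.
  by apply: contraTneq hO => ->; rewrite -rematch_p
    -[rematch q p](_ : twist_walk X p = _) ?inO // twist_walkE op.
have hsq : h != sigma q.
  by apply: contraTneq hO => ->; rewrite -rematch_sigma_p
    -[rematch q _](_ : twist_walk X (sigma p) = _) ?inO // twist_walkE osp.
have osh : o (sigma h).
  by case: (tw) => _ _ _ _ ->; rewrite ?oh // !inE !negb_or hp hsp hq.
rewrite -inO twist_walkE osh rematch_rest ?sigmaK //.
  by rewrite (can2_eq sigmaK sigmaK).
by rewrite (inj_eq (inv_inj sigmaK)).
Qed.

Hypothesis pq : gconn sigma p q.

Lemma twist_walk_gconn X f g : g \in porbit (twist_walk X) f -> gconn sigma f g.
Proof.
case/porbitP=> n ->; elim: n => [|n IH]; first by rewrite expg0 perm1 /gconn connect0.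
rewrite expgSr permM twist_walkE; apply: connect_trans IH _.
move: {f n}(_ f) => f; rewrite -[connect _ _ _]/(gconn sigma f _).
case: ifP => of0; last exact: gconn_gamma.
have [->|fp] := eqVneq f p; first by rewrite rematch_p.
have [->|fsp] := eqVneq f (sigma p); last by rewrite rematch_rest // gconn_sigma.
rewrite rematch_sigma_p; apply: (@connect_trans _ _ p).
  by rewrite -{2}[p]sigmaK; apply: gconn_sigma.
exact: connect_trans pq (gconn_sigma _ _).
Qed.

Hypothesis Rtr : comp_transversal sigma R.

(** Orbits stay inside components, so distinct members of [R] have distinct orbits; equality means
    that there are no others. *)
Lemma card_porbits_twist X :
  (#|R| <= #|porbits (twist_walk X)| ?= iff all_orbits_meet R (twist_walk X))%N.
Proof.
pose O := [set porbit (twist_walk X) r | r in R].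
have cO : #|O| = #|R|.
  apply: card_in_imset => r r' rR r'R e; apply: Rtr.2 => //.
  by apply: (@twist_walk_gconn X); rewrite -eq_porbit_mem e.
have sO : O \subset porbits (twist_walk X).
  by apply/subsetP=> _ /imsetP[r _ ->]; apply: imset_f.
have := subset_leqif_cards sO; rewrite cO.
congr (leqif _ _ _); apply/eqP/all_orbits_meetP => [e f|H].
  have : porbit (twist_walk X) f \in O by rewrite e; apply: imset_f.
  by case/imsetP=> r rR ->; exists r; rewrite // porbit_id.
apply/eqP; rewrite eqEsubset sO; apply/subsetP=> _ /imsetP[f _ ->].
have [r rR rf] := H f; apply/imsetP; exists r => //.
by apply/eqP; rewrite eq_sym eq_porbit_mem.
Qed.

End Fixed.

(** * Comparison of the two rematchings *)

Section Pair.
Variables (q : Flag E) (R : {set Flag E}).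
Hypothesis tw : twisted q.
Hypothesis pR : p \in R.
Hypothesis pq : gconn sigma p q.
Hypothesis Rtr : comp_transversal sigma R.

Let tw' := twisted_sigma tw.
Let s1 := twist_walk tw.
Let s2 := twist_walk tw'.

Let psq : gconn sigma p (sigma q).
Proof. exact: connect_trans pq (gconn_sigma _ _). Qed.

Lemma twist_walk_sigma X : s2 X = (tperm p (sigma p) * s1 X)%g.
Proof.
case: (tw) => op osp oq osq _.
apply/permP=> f; rewrite permM !twist_walkE.
have [->|fp] := eqVneq f p.
  by rewrite tpermL op osp rematch_p // rematch_sigma_p.
have [->|fsp] := eqVneq f (sigma p).
  by rewrite tpermR op osp rematch_p // rematch_sigma_p // sigmaK.
rewrite tpermD 1?eq_sym //; case: ifP => // of0.
by rewrite !rematch_rest.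
Qed.

(** The orbit counts of [s1] and [s2] differ by one and are at least [#|R|], so at most one attains
    it. If [X] is a quasi-tree and [s1] has an orbit missing [R], that orbit is the one of
    [sigma p]; the transposition merges it with the orbit of [p], and [s2] attains [#|R|]. *)
Lemma quasi_tree_twist X :
  (quasi_tree sigma X)%:R =
    (all_orbits_meet R (s1 X))%:R + (all_orbits_meet R (s2 X))%:R :> int.
Proof.
have c1 := card_porbits_twist tw pq Rtr X.
have c2 := card_porbits_twist tw' psq Rtr X.
have /= := porbits_mul_tperm (s1 X) p (sigma p).
rewrite -twist_walk_sigma eq_sym sigma_neq addn1 => cc.
have QTE := quasi_tree_transversal sigmaK X Rtr.
have [a1|na1] := boolP (all_orbits_meet R (s1 X)).
  have -> : quasi_tree sigma X by apply/QTE/(twist_orbits_meet_bconn pR a1).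
  have [a2|//] := boolP (all_orbits_meet R (s2 X)).
  (* Both counts would be [#|R|], although a transposition changes the count by exactly one. *)
  move: cc; rewrite -(eqP (etrans c1.2 a1)) -(eqP (etrans c2.2 a2)).
  case: (p \notin _) => /=.
    by rewrite addn2 => /eqP; rewrite eqSS -addn1 -{2}[#|R|]addn0 eqn_add2l.
  by rewrite addn0 => /eqP; rewrite -{1}[#|R|]addn0 -addn1 eqn_add2l.
rewrite add0r; congr (_%:R); congr nat_of_bool; apply/idP/idP => [/QTE H|a2]; last first.
  by apply/QTE/(twist_orbits_meet_bconn pR a2).
have bad f : (exists2 r, r \in R & r \in porbit (s1 X) f) \/ sigma p \in porbit (s1 X) f.
  case: (boolP [exists r in R, r \in porbit (s1 X) f]) => [/exists_inP|nf]; first by left.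
  right; apply: (bad_orbit_sigma_p pR) (H f) _ => r rR.
  by apply: contra nf => rf; apply/exists_inP; exists r.
have [f nf] : exists f, forall r, r \in R -> r \notin porbit (s1 X) f.
  move: na1; rewrite negb_forall => /existsP[f nf]; exists f => r rR.
  by apply: contra nf => rf; apply/exists_inP; exists r.
have fsp : porbit (s1 X) (sigma p) = porbit (s1 X) f.
  apply/eqP; rewrite eq_porbit_mem.
  by case: (bad f) => // [[r rR]]; rewrite (negPf (nf r rR)).
have np : p \notin porbit (s1 X) (sigma p) by rewrite fsp nf.
have le1 : (#|porbits (s1 X)| <= #|R|.+1)%N.
  pose O := [set porbit (s1 X) r | r in R].
  apply: (@leq_trans #|porbit (s1 X) (sigma p) |: O|); last first.
    by rewrite cardsU1 -add1n leq_add ?leq_b1 ?leq_imset_card.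
  apply/subset_leq_card/subsetP=> _ /imsetP[g _ ->]; rewrite !inE.
  case: (bad g) => [[r rR rg]|spg]; apply/orP; [right|left].
    by apply/imsetP; exists r => //; apply/eqP; rewrite eq_sym eq_porbit_mem.
  by rewrite eq_sym eq_porbit_mem.
rewrite -(geq_leqif c2).
by move: cc; rewrite np /= addn2 => -[cc]; rewrite -ltnS cc.
Qed.

Definition arc_row : 'rV[int]_#|{: Flag E}| :=
  \row_j ((enum_val j == q)%:R - (enum_val j == sigma q)%:R).

(** The reflection in [arc_row] exchanges the images [q] and [sigma q]. Only the positive flags [p]
    and [sigma p] are affected, where the walk ignores the edge set; hence the rank-one term can be
    written with [Q] and is constant in [X]. *)
Lemma twist_walk_sigma_mx Q X :
  fun_mx (s2 X) = fun_mx (s1 X) - fun_mx (s1 Q) *m arc_row^T *m arc_row.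
Proof.
case: (tw) => op osp oq osq _.
set C := fun_mx (s1 Q) *m _; apply/matrixP=> i j.
have -> : (fun_mx (s1 X) - C *m arc_row) i j =
    (enum_val j == s1 X (enum_val i))%:R - C i ord0 * arc_row ord0 j.
  rewrite mxE; congr (_ + _); first by rewrite mxE.
  by rewrite mxE; congr (- _); rewrite mxE big_ord1.
have -> : C i ord0 = (s1 Q (enum_val i) == q)%:R - (s1 Q (enum_val i) == sigma q)%:R.
  by rewrite mul_fun_mx !mxE enum_rankK.
rewrite !mxE; move: (enum_val i) (enum_val j) => f g.
case of0: (o f); last first.
  have of1 : o (s1 Q f) by rewrite o_walk_perm of0.
  have -> : (s1 Q f == q) = false by apply: contraNF oq => /eqP <-.
  have -> : (s1 Q f == sigma q) = false by apply: contraNF osq => /eqP <-.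
  by rewrite subrr mul0r subr0 !twist_walkE of0.
have sq : (q == sigma q) = false by rewrite eq_sym (negPf (sigma_neq _)).
rewrite !twist_walkE of0.
have [->|fp] := eqVneq f p.
  by rewrite !rematch_p // eqxx sq subr0 mul1r opprB addrC subrK.
have [->|fsp] := eqVneq f (sigma p).
  rewrite !rematch_sigma_p // eqxx (negPf (sigma_neq q)) sigmaK sub0r mulN1r opprK.
  by rewrite addrC subrK.
rewrite !rematch_rest // (_ : sigma f == q = false); last first.
  by rewrite (can2_eq sigmaK sigmaK); apply: contraNF osq => /eqP <-.
rewrite (inj_eq (inv_inj sigmaK)) (_ : f == q = false) ?subrr ?mul0r ?subr0 //.
by apply: contraNF oq => /eqP <-.
Qed.

Lemma twisted_matrix_of_orbits Q : quasi_tree sigma Q ->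
  all_orbits_meet R (s1 Q) ->
  exists M : 'M[int]_#|E|, forall X,
    principal_minor M (symdiff Q X) = (quasi_tree sigma X)%:R.
Proof.
move=> QT aQ; pose J := mask_mx (~: R).
have detQ : \det (1%:M - J *m fun_mx (s1 Q)) = 1 by rewrite det_orbits aQ.
have twJ X : 1%:M - J *m fun_mx (s2 X) =
    (1%:M - J *m fun_mx (s1 X)) + J *m fun_mx (s1 Q) *m arc_row^T *m arc_row.
  by rewrite (twist_walk_sigma_mx Q) mulmxBr opprB addrA addrAC !mulmxA.
(* For [Q] the two indicators sum to 1 and the first is already 1. *)
have det0 : \det (1%:M - J *m fun_mx (s1 Q)
                  + J *m fun_mx (s1 Q) *m arc_row^T *m arc_row) = 0.
  rewrite -twJ det_orbits.
  by have := quasi_tree_twist Q; rewrite QT aQ; case: all_orbits_meet.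
have [M HM] := rank_one_pivot_matrix_exists
  (J *m fun_mx (s1 Q) *m (corner_mx o)^T) (corner_mx o) detQ det0.
exists M => X; rewrite HM quasi_tree_twist -!det_orbits -/J twJ.
by rewrite (walk_laplacian o_alpha o_beta (rematch_flip tw) (@rematch_inj q) R Q X).
Qed.

End Pair.

(** Exactly one rematching has all its orbits for [Q] meeting [R]; it supplies the base matrix of
    determinant 1. *)
Lemma twisted_matrix q Q : twisted q -> gconn sigma p q -> quasi_tree sigma Q ->
  exists M : 'M[int]_#|E|, forall X,
    principal_minor M (symdiff Q X) = (quasi_tree sigma X)%:R.
Proof.
move=> tw pq QT; have [R Rtr pR] := comp_transversal_exists sigmaK p.
have := quasi_tree_twist tw pR pq Rtr Q; rewrite QT.
have [a1 _|_] := boolP (all_orbits_meet R _).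
  exact: (twisted_matrix_of_orbits pR pq Rtr QT a1).
have [a2 _|//] := boolP (all_orbits_meet R _).
apply: (twisted_matrix_of_orbits pR _ Rtr QT a2).
exact: connect_trans pq (gconn_sigma _ _).
Qed.

End Rematching.

(** * Two-colourings of pseudo-orientable ribbon graphs *)

(* An odd alternating word in a and b is conjugate to a or b, hence has no
   fixed point, so a f never lies on the orbit of f under the composite of a
   and b. The colouring picks one of these two orbits. *)
Lemma alternating_colouring (T : finType) (a b : T -> T) :
  involutive a -> involutive b -> (forall x, a x != x) -> (forall x, b x != x) ->
  exists c : T -> bool, forall x, c (a x) = ~~ c x /\ c (b x) = ~~ c x.
Proof.
move=> aK bK na nb.
have abI : injective (a \o b) by apply: inj_comp; exact: inv_inj.
pose s := perm abI; have sE x : s x = a (b x) by rewrite permE.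
have sna n x : (s ^+ n)%g x != a x.
  suff: (s ^+ n)%g x != a x /\ (s ^+ n.+1)%g x != a x by case.
  elim: n x => [|n IH] x.
    by rewrite expg0 expg1 perm1 sE (inj_eq (inv_inj aK)) nb eq_sym na.
  split; first by case: (IH x).
  rewrite expgS permM expgSr permM sE (inj_eq (inv_inj aK)) (can2_eq bK bK).
  by rewrite -[b x]aK -sE; case: (IH (s x)).
have porb x : porbit s (b x) = porbit s (a x).
  by rewrite -(porbit_step s (b x)) sE bK.
pose rk x := enum_rank (porbit s x).
have rkN x : rk x != rk (a x) :> nat.
  rewrite (inj_eq val_inj) (inj_eq enum_rank_inj) eq_sym eq_porbit_mem.
  by apply/porbitP=> -[n En]; case/eqP: (sna n x).
exists (fun x => rk x < rk (a x))%N => x; split.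
  by rewrite aK -leqNgt ltn_neqAle eq_sym rkN.
have -> : rk (b x) = rk (a x) by rewrite /rk porb.
have -> : rk (a (b x)) = rk x by rewrite /rk -sE porbit_step.
by rewrite -leqNgt ltn_neqAle eq_sym rkN.
Qed.

Section Components.
Variables (E : finType) (sigma : Flag E -> Flag E).
Hypothesis sigmaK : involutive sigma.
Implicit Types (f g : Flag E) (K : {set Flag E}).

Lemma comps_gconn K f g : K \in comps sigma -> f \in K -> gconn sigma f g = (g \in K).
Proof.
case/imsetP=> f0 _ ->; rewrite !inE => f0f; apply/esym.
exact: (same_connect (gconn_sym sigmaK) f0f).
Qed.

Lemma comps_closed K f : K \in comps sigma -> f \in K ->
  [/\ sigma f \in K, alpha f \in K & beta f \in K].
Proof.
by move=> Kc fK; rewrite -!(comps_gconn _ Kc fK);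
  split; [apply: gconn_sigma | apply: gconn_alpha | apply: gconn_beta].
Qed.

Lemma mem_comp_of f : f \in [set g | gconn sigma f g].
Proof. by rewrite inE /gconn connect0. Qed.

Lemma comp_of_comps f : [set g | gconn sigma f g] \in comps sigma.
Proof. exact: imset_f. Qed.

Lemma glue_colourings (P : {set Flag E} -> (Flag E -> bool) -> Prop) :
  (forall K, K \in comps sigma -> exists c, P K c) ->
  exists o : Flag E -> bool, forall K, K \in comps sigma ->
    exists2 c, P K c & {in K, o =1 c}.
Proof.
move=> H; have [C HC] : exists C : {set Flag E} -> Flag E -> bool,
    forall K, K \in comps sigma -> P K (C K).
  apply: (fin_all_exists (P := fun K c => K \in comps sigma -> P K c)) => K.
  have [/H[c]|] := boolP (K \in comps sigma); first by exists c.
  by exists (fun=> false).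
exists (fun f => C [set g | gconn sigma f g] f) => K Kc.
exists (C K); first exact: HC.
move=> f fK; congr (C _ f); apply/setP=> g; rewrite inE.
exact: comps_gconn.
Qed.

(** By [alpha] both colours occur equally often in [K], so once [sigma] maps class [b] into the
    other class it does so bijectively. Failures therefore occur in both colours or in neither. *)
Lemma colour_balance K (o : Flag E -> bool) (b : bool) :
  K \in comps sigma -> (forall f, f \in K -> o (alpha f) = ~~ o f) ->
  (forall f, f \in K -> o f = b -> o (sigma f) = ~~ b) ->
  forall f, f \in K -> o f = ~~ b -> o (sigma f) = b.
Proof.
move=> Kc oa H f fK ofb.
pose Kb d := [set g in K | o g == d].
have card_le d : (#|Kb d| <= #|Kb (~~ d)|)%N.
  rewrite -(card_imset _ (inv_inj (@alphaK E))); apply/subset_leq_card/subsetP.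
  move=> _ /imsetP[g + ->]; rewrite !inE => /andP[gK /eqP og].
  by rewrite oa // og eqxx; case: (comps_closed Kc gK) => _ ->.
have : sigma @: Kb b == Kb (~~ b).
  have := card_le (~~ b); rewrite negbK => le_b.
  rewrite eqEcard (card_imset _ (inv_inj sigmaK)) le_b andbT.
  apply/subsetP=> _ /imsetP[g + ->].
  rewrite !inE => /andP[gK /eqP og]; rewrite H // eqxx andbT.
  by case: (comps_closed Kc gK).
move/eqP/setP/(_ f); rewrite !inE fK ofb eqxx => /imsetP[g].
by rewrite !inE => /andP[_ /eqP og] ->; rewrite sigmaK.
Qed.

Hypothesis sigma_neq : forall f, sigma f != f.

(** Let [d] alternate around the vertex circle and let [c] label the two arcs. Along a loop exactly
    one of [d] and [c] changes: [d] if it is orientable, [c] if not. So their sum flips under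
    [alpha] and [beta], and fails along [sigma] only where [c] changes. *)
Lemma pseudo_bouquet_colouring K :
  (forall f, f \in K -> [/\ sigma f \in K, alpha f \in K & beta f \in K]) ->
  pseudo_bouquet_on sigma K ->
  exists o : Flag E -> bool,
    [/\ forall f, f \in K -> o (alpha f) = ~~ o f,
        forall f, f \in K -> o (beta f) = ~~ o f &
        (#|[set f in K | o (sigma f) == o f]| <= 4)%N].
Proof.
move=> Kcl [/eqP/cards1P[C EC] [c [ca cs cl]]].
have vK f g : f \in K -> g \in K -> vconn sigma f g.
  have inC h : h \in K -> [set g | vconn sigma h g] = C.
    by move=> hK; apply/set1P; rewrite -EC; apply: imset_f.
  move=> fK gK; have : g \in [set h | vconn sigma g h] by rewrite inE /vconn connect0.
  by rewrite (inC g gK) -(inC f fK) inE.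
have na f : alpha f != f.
  by case: f => [[e i] s]; apply/eqP; case; case: s.
have [d Hd] := alternating_colouring sigmaK (@alphaK E) sigma_neq na.
have ds f : d (sigma f) = ~~ d f by case: (Hd f).
have da f : d (alpha f) = ~~ d f by case: (Hd f).
have loopP e : (e, false, false) \in K ->
    d (e, true, false) (+) c (e, true, false) =
    ~~ (d (e, false, false) (+) c (e, false, false)).
  move=> eK; have bK : (e, true, false) \in K by have [_ _] := Kcl _ eK.
  have [cl1 cl2] := cl _ eK.
  have [de|de] := eqVneq (d (e, true, false)) (d (e, false, false)); last first.
    rewrite -cl1; first by move: de; do 3! case: (_ (_, _, _)).
    exists d => f; split; rewrite ?ds ?da; try by case: (d f).
    case: f => [[e' i] s]; rewrite inE /fedge /= => /eqP->.
    have dt j : d (e, j, true) = ~~ d (e, j, false) by rewrite -da.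
    by move: de; case: i; case: s; rewrite /beta /= ?dt; do 2! case: (d _).
  rewrite de; have /cl2 : ~ orientable_loop sigma e.
    (* On a single vertex circle two alternating colourings differ by a constant, so [d] decides
       whether the loop is orientable. *)
    case=> c1 Hc1; have : d (e, true, false) (+) c1 (e, true, false)
                         = d (e, false, false) (+) c1 (e, false, false).
      have /connectP[t] := vK _ _ eK bK.
      elim: t (e, false, false) => [|h t IH] x /=; first by move=> _ ->.
      case/andP=> step pt el; rewrite (IH h pt el).
      have [s1 s2 _] := Hc1 x; case/orP: step => /eqP->; rewrite ?ds ?da.
        by move: s1; case: (c1 _); case: (c1 _); case: (d _).
      by move: s2; case: (c1 _); case: (c1 _); case: (d _).
    rewrite de; have [_ _] := Hc1 (e, false, false).
    rewrite inE eqxx => /(_ isT); rewrite /beta /=.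
    by do 3! case: (_ (_, _, _)).
  by do 3! case: (_ (_, _, _)).
exists (fun f => d f (+) c f); split=> [f fK|f fK|].
- by rewrite da ca // addNb.
- case: f fK => [[e i] s] fK; rewrite /beta /=.
  have eK : (e, false, false) \in K.
    have key g : g \in K -> (alpha g \in K) /\ (beta g \in K) by case/Kcl.
    case: i s fK => [] [] // /key[k1 k2] //.
    by case/key: k1.
  have bK : (e, true, false) \in K by have [_ _] := Kcl _ eK.
  have dt j : d (e, j, true) = ~~ d (e, j, false) by rewrite -da.
  have ct j : c (e, j, true) = c (e, j, false).
    by rewrite -[RHS]ca //; case: j.
  have := loopP e eK; case: i s {fK} => [] []; rewrite /= ?dt ?ct;
    by case: (d (e, true, false)); case: (c (e, true, false));
    case: (d (e, false, false)); case: (c (e, false, false)).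
- apply: leq_trans cs; apply/subset_leq_card/subsetP=> f; rewrite !inE.
  case/andP=> -> /=; rewrite ds.
  by do 2! case: (c _); case: (d _).
Qed.

End Components.

Lemma pdual_ribbon (E : finType) (sigma : Flag E -> Flag E) (X : {set E}) :
  involutive sigma -> (forall f, sigma f != f) ->
  involutive (pdual sigma X) /\ (forall f, pdual sigma X f != f).
Proof.
move=> sigmaK sigma_neq; split=> f; rewrite /pdual; first by rewrite rhoK sigmaK rhoK.
by rewrite (can2_eq (rhoK X) (rhoK X)) sigma_neq.
Qed.

(** Conjugation by [rho X] takes [sigma] to its partial dual and exchanges [alpha] and [beta] on the
    edges of [X]. A colouring flipped by both therefore pulls back. *)
Lemma pseudo_orientable_colouring (E : finType) (sigma : Flag E -> Flag E) K :
  involutive sigma -> (forall f, sigma f != f) ->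
  K \in comps sigma -> pseudo_orientable_on sigma K ->
  exists o : Flag E -> bool,
    [/\ forall f, f \in K -> o (alpha f) = ~~ o f,
        forall f, f \in K -> o (beta f) = ~~ o f &
        (#|[set f in K | o (sigma f) == o f]| <= 4)%N].
Proof.
move=> sigmaK sigma_neq Kc [X [_ _ pb]].
have Kcl f := @comps_closed _ _ sigmaK K f Kc.
have Kr f : f \in K -> rho X f \in K.
  case: f => [[e i] s] fK; rewrite /rho; case: ifP => _ //.
  have [_ aK _] := Kcl _ fK; have [_ _ bK] := Kcl _ fK; have [_ abK _] := Kcl _ bK.
  by move: fK aK bK abK; rewrite /alpha /beta /=; case: i; case: s.
have [pdK pd_neq] := pdual_ribbon X sigmaK sigma_neq.
have Kcl' f : f \in K -> [/\ pdual sigma X f \in K, alpha f \in K & beta f \in K].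
  move=> fK; have [_ aK bK] := Kcl _ fK; split=> //.
  by apply: (Kr); have [] := Kcl _ (Kr _ fK).
have [o [oa ob ocard]] := pseudo_bouquet_colouring pdK pd_neq Kcl' pb.
have rhoa f : rho X (alpha f) = if fedge f \in X then beta (rho X f) else alpha (rho X f).
  by case: f => [[e i] s]; rewrite /rho /fedge /=; case: ifP.
have rhob f : rho X (beta f) = if fedge f \in X then alpha (rho X f) else beta (rho X f).
  by case: f => [[e i] s]; rewrite /rho /fedge /=; case: ifP.
exists (o \o rho X); split=> [f fK|f fK|] /=.
- by rewrite rhoa; case: ifP => _; rewrite ?oa ?ob ?Kr.
- by rewrite rhob; case: ifP => _; rewrite ?oa ?ob ?Kr.
apply: leq_trans ocard; rewrite -(card_imset _ (inv_inj (rhoK X))).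
apply/subset_leq_card/subsetP=> _ /imsetP[f + ->]; rewrite !inE => /andP[fK of0].
by rewrite Kr //= /pdual rhoK.
Qed.

(** * Reduction to an alternating or a twisted colouring *)

Lemma pseudo_orientable_matrix (E : finType) (sigma : Flag E -> Flag E) (niso : nat)
    (Q : {set E}) :
  is_ribbon sigma -> pseudo_orientable sigma niso -> quasi_tree sigma Q ->
  exists M : 'M[int]_#|E|, forall X,
    principal_minor M (symdiff Q X) = (quasi_tree sigma X)%:R.
Proof.
case=> sigmaK sigma_neq po QT.
pose flips (K : {set Flag E}) (c : Flag E -> bool) := forall f, f \in K ->
  c (alpha f) = ~~ c f /\ c (beta f) = ~~ c f.
pose bad (K : {set Flag E}) (c : Flag E -> bool) := [set f in K | c (sigma f) == c f].
have [K0 HK0] : exists K0, forall K, K \in comps sigma -> exists c,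
    flips K c /\ (if K == K0 then #|bad K c| <= 4 else #|bad K c| == 0)%N.
  have orient K : orientable_on sigma K -> exists c, flips K c /\ #|bad K c| == 0%N.
    case=> c Hc; exists c; split=> [f /Hc/and3P[_ a b]|].
      by move: a b; do 3! case: (c _).
    apply/eqP/eq_card0 => f; rewrite inE.
    by apply/andP=> -[/Hc/and3P[/negPf->]].
  case: po => [[K0 K0c [poK0 oK]]|[_ oK]].
    exists K0 => K Kc; case: eqVneq => [->|/(oK _ Kc)/orient//].
    have [c [ca cb cc]] := pseudo_orientable_colouring sigmaK sigma_neq K0c poK0.
    by exists c; split=> // f fK; split; [apply: ca | apply: cb].
  (* Here no component is exceptional; having no failures satisfies either bound. *)
  exists set0 => K Kc; have [c [cf /eqP c0]] := orient _ (oK K Kc).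
  by exists c; split; rewrite // c0; case: ifP.
have [o Ho] := glue_colourings sigmaK HK0.
have oP K : K \in comps sigma ->
    flips K o /\ (if K == K0 then #|bad K o| <= 4 else #|bad K o| == 0)%N.
  move=> Kc; have [c [cf cb] oc] := Ho K Kc.
  have -> : bad K o = bad K c.
    apply/setP=> f; rewrite !inE; case fK: (f \in K) => //=.
    by have [sK _ _] := comps_closed sigmaK Kc fK; rewrite !oc.
  split=> // f fK; have [_ aK bK] := comps_closed sigmaK Kc fK.
  by rewrite !oc //; apply: cf.
have mc f : f \in [set g | gconn sigma f g] by exact: mem_comp_of.
have o_alpha f : o (alpha f) = ~~ o f.
  by have [/(_ _ (mc f))[]] := oP _ (comp_of_comps sigma f).
have o_beta f : o (beta f) = ~~ o f.
  by have [/(_ _ (mc f))[]] := oP _ (comp_of_comps sigma f).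
have o_sigma K f : K \in comps sigma -> f \in K -> f \notin bad K o ->
    o (sigma f) = ~~ o f.
  by move=> Kc fK; rewrite inE fK /=; do 2! case: (o _).
have o_sigma_out f : f \notin K0 -> o (sigma f) = ~~ o f.
  move=> fK0; have Kc := comp_of_comps sigma f.
  apply: (o_sigma _ _ Kc (mc f)); have [_] := oP _ Kc.
  case: eqVneq => [EK|_]; first by move: fK0; rewrite -EK mc.
  by rewrite cards_eq0 => /eqP->; rewrite inE.
have oriented : (forall f, f \in K0 -> o (sigma f) = ~~ o f) ->
    exists M : 'M[int]_#|E|, forall X,
      principal_minor M (symdiff Q X) = (quasi_tree sigma X)%:R.
  move=> o_in; apply: (orientable_matrix sigmaK o_alpha o_beta _ QT) => f.
  by have [/o_in|/o_sigma_out] := boolP (f \in K0).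
have [K0c|K0nc] := boolP (K0 \in comps sigma); last first.
  apply: oriented => f fK0; have Kc := comp_of_comps sigma f.
  apply: (o_sigma _ _ Kc (mc f)); have [_] := oP _ Kc.
  case: eqVneq => [EK|_]; first by move: K0nc; rewrite -EK Kc.
  by rewrite cards_eq0 => /eqP->; rewrite inE.
have [_] := oP _ K0c; rewrite eqxx => card_bad.
have balance b := @colour_balance _ _ sigmaK K0 o b K0c (fun f _ => o_alpha f).
have no_bad b : (forall f, f \in bad K0 o -> o f != b) ->
    forall f, f \in K0 -> o (sigma f) = ~~ o f.
  move=> nb; have Hb f : f \in K0 -> o f = b -> o (sigma f) = ~~ b.
    move=> fK ofb; rewrite -ofb; apply: (o_sigma _ _ K0c fK).
    by apply/negP=> /nb; rewrite ofb eqxx.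
  move=> f fK; have [ofb|ofb] := eqVneq (o f) b; first by rewrite ofb Hb.
  have ofb' : o f = ~~ b by move: ofb; case: (o f); case: (b).
  by rewrite (balance b Hb) // ofb' negbK.
have find_bad b : (exists2 f, f \in bad K0 o & o f = b) \/
    forall f, f \in K0 -> o (sigma f) = ~~ o f.
  case: (pickP [pred f in bad K0 o | o f == b]) => [f /= /andP[fb /eqP of0]|none].
    by left; exists f.
  right; apply: (no_bad b) => f fb; have := none f; rewrite /= fb /=.
  by move=> ->.
case: (find_bad true) => [[p pb op]|/oriented//].
case: (find_bad false) => [[q qb oq]|/oriented//].
move: (pb) (qb); rewrite !inE op oq => /andP[pK /eqP osp] /andP[qK /eqP osq].
apply: (twisted_matrix sigmaK sigma_neq o_alpha o_beta (p := p) (q := q)) => //;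
  last first.
  by rewrite (comps_gconn sigmaK _ K0c).
split; rewrite ?op ?osp ?oq ?osq // => f nf.
have [fK|/o_sigma_out//] := boolP (f \in K0).
apply: (o_sigma _ _ K0c fK); apply: contraNN nf => fb.
(* These four flags are distinct failures and there are at most four, so they are all of them. *)
have badE : [set x in [:: p; sigma p; q; sigma q]] == bad K0 o.
  rewrite eqEcard; apply/andP; split.
    have [spK _ _] := comps_closed sigmaK K0c pK.
    have [sqK _ _] := comps_closed sigmaK K0c qK.
    apply/subsetP=> x; rewrite !inE.
    by case/or4P=> /eqP->; rewrite ?pK ?spK ?qK ?sqK ?sigmaK ?op ?osp ?oq ?osq.
  apply: leq_trans card_bad _; rewrite cardsE.
  have neq x y : o x = true -> o y = false -> (x == y) = false.
    by move=> ox oy; apply/eqP=> e; move: ox; rewrite e oy.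
  have /card_uniqP-> // : uniq [:: p; sigma p; q; sigma q].
  rewrite /= !inE (neq p q) // (neq p (sigma q)) // (neq (sigma p) q) //.
  by rewrite (neq (sigma p) (sigma q)) // !(eq_sym _ (sigma _)) !(negPf (sigma_neq _)).
by move: fb; rewrite -(eqP badE) inE.
Qed.

Theorem theorem1p2 (E : finType) (sigma : Flag E -> Flag E) (niso : nat)
    (Q : {set E}) :
  is_ribbon sigma -> pseudo_orientable sigma niso -> quasi_tree sigma Q ->
  exists M : 'M[int]_#|E|,
    [/\ principally_unimodular M,
        forall X : {set E},
          principal_minor M (symdiff Q X) = (if quasi_tree sigma X then 1 else 0)
      & \det (1%:M + M) = (#|[set X : {set E} | quasi_tree sigma X]|)%:Z].
Proof.
move=> rib po QT; have [M HM] := pseudo_orientable_matrix rib po QT.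
exists M; split=> [Y|X|].
(* Every index set has the form [symdiff Q X], so the formula covers all principal minors. *)
- by rewrite -(symdiffK Q Y) HM; case: (quasi_tree _ _); rewrite !inE eqxx ?orbT.
- by rewrite HM; case: (quasi_tree _ _).
rewrite det_add1_sum_minors (reindex_inj (inv_inj (symdiffK Q))) /=.
rewrite (eq_bigr (fun X => (quasi_tree sigma X)%:R)) => [|X _]; last exact: HM.
by rewrite -natr_sum natz -sum1dep_card [in RHS]big_mkcond.
Qed.
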